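(* All of the equations $(\Delta_{\alpha}, \nabla_{\!\beta})^{*}$ are canonical: whenever a modal algebra (a Heyting, co-Heyting or bi-Heyting algebra as required by the connectives of the equation) satisfies $(\Delta_{\alpha}, \nabla_{\!\beta})^{*}$, its canonical frame satisfies the corresponding frame condition $(\Delta_{\alpha}, \nabla_{\!\beta})^{*}$ (equivalently, its canonical extension satisfies the equation).
   Context: Forward modal operators on a bounded distributive lattice: $\Box_+$ preserves finite meets; $\Diamond_+$ preserves finite joins; $\Box_-(a\vee b)=\Box_-a\wedge\Box_-b$, $\Box_-\bot=\top$; $\Diamond_-(a\wedge b)=\Diamond_-a\vee\Diamond_-b$, $\Diamond_-\top=\bot$. $\rightarrow$ is Heyting implication, $-$ co-implication. The canonical frame of such an algebra $\mathbf{A}$ is the set of prime filters ordered by inclusion with $\mathcal{U}R^\Box_+\mathcal{V}$ iff ($\Box_+a\in\mathcal{U}\Rightarrow a\in\mathcal{V}$), $\mathcal{U}R^\Box_-\mathcal{V}$ iff ($\Box_-a\in\mathcal{U}\Rightarrow a\notin\mathcal{V}$), $\mathcal{U}R^\Diamond_+\mathcal{V}$ iff ($a\in\mathcal{V}\Rightarrow\Diamond_+a\in\mathcal{U}$), $\mathcal{U}R^\Diamond_-\mathcal{V}$ iff ($a\notin\mathcal{V}\Rightarrow\Diamond_-a\in\mathcal{U}$); the canonical extension is the complex algebra of upsets of this frame. Equations / frame conditions (backward modalities $\overleftarrow{\Box}_\alpha,\overleftarrow{\Diamond}_\alpha$ used only as labels): $(\Diamond_+,\Box_+)^*$: $\Box_+a\wedge\Diamond_+b\le\Diamond_+(a\wedge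 b)$ / $R^\Diamond_+\subseteq(R^\Diamond_+\cap R^\Box_+)\circ{\ge}$; $(\Diamond_-,\Box_-)^*$: $\Box_-a\wedge\Diamond_-b\le\Diamond_-(a\vee b)$ / $R^\Diamond_-\subseteq(R^\Diamond_-\cap R^\Box_-)\circ{\le}$; $(\Box_+,\Diamond_+)^*$: $\Box_+(a\vee b)\le\Box_+a\vee\Diamond_+b$ / $R^\Box_+\subseteq(R^\Box_+\cap R^\Diamond_+)\circ{\le}$; $(\Box_-,\Diamond_-)^*$: $\Box_-(a\wedge b)\le\Box_-a\vee\Diamond_-b$ / $R^\Box_-\subseteq(R^\Box_-\cap R^\Diamond_-)\circ{\ge}$; $(\Diamond_+,\Box_-)^*$: $\Box_-a\wedge\Diamond_+a\le\bot$ / $R^\Diamond_+\subseteq R^\Box_-$; $(\Diamond_-,\Box_+)^*$: $\Box_+a\wedge\Diamond_-a\le\bot$ / $R^\Diamond_-\subseteq R^\Box_+$; $(\Box_+,\Diamond_-)^*$: $\top\le\Box_+a\vee\Diamond_-a$ / $R^\Box_+\subseteq R^\Diamond_-$; $(\Box_-,\Diamond_+)^*$: $\top\le\Box_-a\vee\Diamond_+a$ / $R^\Box_-\subseteq R^\Diamond_+$; $(\overleftarrow{\Diamond}_+,\overleftarrow{\Box}_+)^*$: $\Diamond_+a\rightarrow\Box_+b\le\Box_+(a\rightarrow b)$ / $R^\Box_+\subseteq{\le}\circ(R^\Box_+\cap R^\Diamond_+)$; $(\overleftarrow{\Diamond}_-,\overleftarrow{\Box}_-)^*$: $\Diamond_-(a\rightarrow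 b)\le\Diamond_-b-\Box_-a$ / $R^\Diamond_-\subseteq{\ge}\circ(R^\Diamond_-\cap R^\Box_-)$; $(\overleftarrow{\Box}_+,\overleftarrow{\Diamond}_+)^*$: $\Diamond_+(b-a)\le\Diamond_+b-\Box_+a$ / $R^\Diamond_+\subseteq{\ge}\circ(R^\Diamond_+\cap R^\Box_+)$; $(\overleftarrow{\Box}_-,\overleftarrow{\Diamond}_-)^*$: $\Diamond_-a\rightarrow\Box_-b\le\Box_-(b-a)$ / $R^\Box_-\subseteq{\le}\circ(R^\Box_-\cap R^\Diamond_-)$; $(\overleftarrow{\Diamond}_+,\overleftarrow{\Box}_-)^*$: $\Box_-a\le\Box_+(a\rightarrow\bot)$ / $R^\Box_+\subseteq R^\Box_-$; $(\overleftarrow{\Diamond}_-,\overleftarrow{\Box}_+)^*$: $\Diamond_-(a\rightarrow\bot)\le\Diamond_+a$ / $R^\Diamond_-\subseteq R^\Diamond_+$; $(\overleftarrow{\Box}_+,\overleftarrow{\Diamond}_-)^*$: $\Diamond_+(\top-a)\le\Diamond_-a$ / $R^\Diamond_+\subseteq R^\Diamond_-$; $(\overleftarrow{\Box}_-,\overleftarrow{\Diamond}_+)^*$: $\Box_+a\le\Box_-(\top-a)$ / $R^\Box_-\subseteq R^\Box_+$. *)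

(* Defs.v *)
From HB Require Import structures.
From mathcomp Require Import all_boot all_order.
From mathcomp Require Import boolp classical_sets.

Set Implicit Arguments.
Unset Strict Implicit.
Unset Printing Implicit Defensive.

Import Order.TTheory.
Local Open Scope order_scope.

Inductive sign := Plus | Minus.

Inductive term :=
  | Var of nat
  | TTop | TBot
  | TMeet of term & term
  | TJoin of term & term
  | TImp of term & term
  | TCoimp of term & term
  | TBox of sign & term
  | TDia of sign & term.

Inductive connective := Imp | Coimp | Box of sign | Dia of sign.

Fixpoint occurs (c : connective) (t : term) : Prop :=
  match t with
  | Var _ | TTop | TBot => False
  | TMeet s t | TJoin s t => occurs c s \/ occurs c t
  | TImp s t => c = Imp \/ occurs c s \/ occurs c t
  | TCoimp s t => c = Coimp \/ occurs c s \/ occurs c t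
  | TBox e t => c = Box e \/ occurs c t
  | TDia e t => c = Dia e \/ occurs c t
  end.

(* The pair (s, t) stands for the inequality s <= t. *)
Definition inequality := (term * term)%type.

Definition occurs_in (c : connective) (E : inequality) : Prop :=
  occurs c E.1 \/ occurs c E.2.

(* [coimp a b] is the co-implication a - b. *)
Record operations (A : Type) := Operations {
  imp : A -> A -> A;
  coimp : A -> A -> A;
  box : sign -> A -> A;
  dia : sign -> A -> A }.

Section Algebra.
Context {d : Order.disp_t} {A : tbDistrLatticeType d} (o : operations A).

Definition connective_law (c : connective) : Prop :=
  match c with
  | Imp => forall a b x : A, (x <= imp o a b) = (x `&` a <= b)
  | Coimp => forall a b x : A, (coimp o a b <= x) = (a <= b `|` x)
  | Box Plus => box o Plus \top = \top /\
      forall a b, box o Plus (a `&` b) = box o Plus a `&` box o Plus b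
  | Box Minus => box o Minus \bot = \top /\
      forall a b, box o Minus (a `|` b) = box o Minus a `&` box o Minus b
  | Dia Plus => dia o Plus \bot = \bot /\
      forall a b, dia o Plus (a `|` b) = dia o Plus a `|` dia o Plus b
  | Dia Minus => dia o Minus \top = \bot /\
      forall a b, dia o Minus (a `&` b) = dia o Minus a `|` dia o Minus b
  end.

(* A has at least the structure that the connectives of E call for; the
   components of o that do not occur in E are left unconstrained. *)
Definition algebra_for (E : inequality) : Prop :=
  forall c, occurs_in c E -> connective_law c.

Fixpoint eval (v : nat -> A) (t : term) : A :=
  match t with
  | Var i => v i
  | TTop => \top
  | TBot => \bot
  | TMeet s t => eval v s `&` eval v t
  | TJoin s t => eval v s `|` eval v t
  | TImp s t => imp o (eval v s) (eval v t)
  | TCoimp s t => coimp o (eval v s) (eval v t)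
  | TBox e t => box o e (eval v t)
  | TDia e t => dia o e (eval v t)
  end.

Definition satisfies (E : inequality) : Prop :=
  forall v : nat -> A, eval v E.1 <= eval v E.2.

End Algebra.

Definition signed_le (W : Type) (le : W -> W -> Prop) (e : sign) (u v : W) :=
  if e is Plus then le u v else le v u.

(* Rbox_fle says <= o Rbox Plus o <= is contained in Rbox Plus and
   <= o Rbox Minus o >= in Rbox Minus; Rdia_fle says >= o Rdia Plus o >= is
   contained in Rdia Plus and >= o Rdia Minus o <= in Rdia Minus. *)
Record frame := Frame {
  world :> Type;
  fle : world -> world -> Prop;
  Rbox : sign -> world -> world -> Prop;
  Rdia : sign -> world -> world -> Prop;
  fle_refl : forall u, fle u u;
  fle_trans : forall u v w, fle u v -> fle v w -> fle u w;
  fle_anti : forall u v, fle u v -> fle v u -> u = v;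
  Rbox_fle : forall e u u' v' v,
    fle u u' -> Rbox e u' v' -> signed_le fle e v' v -> Rbox e u v;
  Rdia_fle : forall e u u' v' v,
    fle u' u -> Rdia e u' v' -> signed_le fle e v v' -> Rdia e u v }.

(* Composition in diagrammatic order: first R, then S. *)
Definition rel_comp (W : Type) (R S : W -> W -> Prop) (u v : W) : Prop :=
  exists2 w, R u w & S w v.

Definition rel_cap (W : Type) (R S : W -> W -> Prop) (u v : W) : Prop :=
  R u v /\ S u v.

Definition rel_incl (W : Type) (R S : W -> W -> Prop) : Prop :=
  forall u v, R u v -> S u v.

Section Upsets.
Variable F : frame.

Definition is_upset : {pred set F} :=
  fun X => `[< forall u v, fle u v -> X u -> X v >].

Fact upset_meet_closed : {in is_upset &, forall X Y, X `&` Y \in is_upset}.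
Proof.
move=> X Y /asboolP uX /asboolP uY; apply/asboolP=> u v uv [Xu Yu].
by split; [exact: uX uv Xu | exact: uY uv Yu].
Qed.

Fact upset_join_closed : {in is_upset &, forall X Y, X `|` Y \in is_upset}.
Proof.
move=> X Y /asboolP uX /asboolP uY; apply/asboolP=> u v uv [Xu|Yu].
  by left; exact: uX uv Xu.
by right; exact: uY uv Yu.
Qed.

Fact upset_bot_closed : \bot \in is_upset.
Proof. exact/asboolP. Qed.

Fact upset_top_closed : \top \in is_upset.
Proof. exact/asboolP. Qed.

Record upset := Upset { upset_set : set F; _ : upset_set \in is_upset }.

Definition upset_mem (X : upset) : F -> Prop := upset_set X.
Coercion upset_mem : upset >-> Funclass.
Arguments upset_mem : simpl never.

HB.instance Definition _ := [isSub for upset_set].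
HB.instance Definition _ := [Choice of upset by <:].
HB.instance Definition _ := Order.SubChoice_isTBSubLattice.Build
  set_display (set F) is_upset set_display upset
  upset_meet_closed upset_join_closed upset_bot_closed upset_top_closed.

Fact upset_meetUl : @left_distributive upset upset Order.meet Order.join.
Proof. by move=> x y z; apply: val_inj; exact: meetUl. Qed.

HB.instance Definition _ :=
  Order.Lattice_Meet_isDistrLattice.Build set_display upset upset_meetUl.

Lemma upsetP (X : upset) u v : fle u v -> X u -> X v.
Proof. by have /asboolP := valP X; apply. Qed.

Definition mk_upset (X : set F) (uX : forall u v, fle u v -> X u -> X v) :
  upset := Upset (asboolT uX).

Fact imp_up (X Y : upset) u v : fle u v ->
  (forall w, fle u w -> X w -> Y w) -> forall w, fle v w -> X w -> Y w.
Proof. by move=> uv H w vw; apply: H; exact: fle_trans uv vw. Qed.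

Fact coimp_up (X Y : upset) u v : fle u v ->
  (exists w, [/\ fle w u, X w & ~ Y w]) ->
  exists w, [/\ fle w v, X w & ~ Y w].
Proof.
by move=> uv [w [wu Xw Yw]]; exists w; split=> //; exact: fle_trans wu uv.
Qed.

Definition signed_mem (e : sign) (X : upset) (v : F) : Prop :=
  if e is Plus then X v else ~ X v.

Fact box_up e (X : upset) u v : fle u v ->
  (forall w, Rbox e u w -> signed_mem e X w) ->
  forall w, Rbox e v w -> signed_mem e X w.
Proof.
move=> uv H w vw; apply: H; apply: Rbox_fle uv vw _.
by case: e; exact: fle_refl.
Qed.

Fact dia_up e (X : upset) u v : fle u v ->
  (exists2 w, Rdia e u w & signed_mem e X w) ->
  exists2 w, Rdia e v w & signed_mem e X w.
Proof.
move=> uv [w uw Xw]; exists w => //; apply: Rdia_fle uv uw _.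
by case: e {Xw}; exact: fle_refl.
Qed.

Definition complex_algebra : operations upset := {|
  imp X Y := mk_upset (@imp_up X Y);
  coimp X Y := mk_upset (@coimp_up X Y);
  box e X := mk_upset (@box_up e X);
  dia e X := mk_upset (@dia_up e X) |}.

Lemma le_upsetP (X Y : upset) : reflect (forall u, X u -> Y u) (X <= Y).
Proof. exact: subsetPset. Qed.

Lemma eq_upsetP (X Y : upset) : (forall u, X u <-> Y u) -> X = Y.
Proof. by move=> H; apply/val_inj/seteqP; split=> u /H. Qed.

Lemma upset_meetE (X Y : upset) u : (X `&` Y) u = (X u /\ Y u).
Proof. by []. Qed.

Lemma upset_joinE (X Y : upset) u : (X `|` Y) u = (X u \/ Y u).
Proof. by []. Qed.

Lemma upset_botE u : (\bot : upset) u = False.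
Proof. by []. Qed.

Lemma upset_topE u : (\top : upset) u = True.
Proof. by []. Qed.

Lemma complex_algebra_law c : connective_law complex_algebra c.
Proof.
case: c => [||[]|[]] /=.
- move=> X Y Z; apply/le_upsetP/le_upsetP => [H u|H u Zu w uw Xw].
    rewrite upset_meetE => -[Zu Xu].
    by apply: (H _ Zu) => //; exact: fle_refl.
  by apply: H; rewrite upset_meetE; split=> //; exact: upsetP uw Zu.
- move=> X Y Z; apply/le_upsetP/le_upsetP => [H u Xu|H u [w [wu Xw nYw]]].
    rewrite upset_joinE; have [Yu|nYu] := pselect (Y u); [by left | right].
    by apply: H; exists u; split=> //; exact: fle_refl.
  by have := H _ Xw; rewrite upset_joinE => -[//|]; exact: upsetP wu.
- split=> [|X Y]; apply: eq_upsetP => u.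
    by rewrite upset_topE; split=> // _ w _ /=; rewrite upset_topE.
  rewrite upset_meetE /=; split=> [H|[H1 H2] w uw].
    by split=> w /H /=; rewrite upset_meetE => -[].
  by rewrite /= upset_meetE; split; [exact: H1 | exact: H2].
- split=> [|X Y]; apply: eq_upsetP => u.
    by rewrite upset_topE; split=> // _ w _ /=; rewrite upset_botE.
  rewrite upset_meetE /=; split=> [H|[H1 H2] w uw].
    by split=> w /H /=; rewrite upset_joinE => /not_orP[].
  by rewrite /= upset_joinE => -[]; [exact: H1 | exact: H2].
- split=> [|X Y]; apply: eq_upsetP => u.
    by rewrite upset_botE; split=> // -[w _] /=; rewrite upset_botE.
  rewrite upset_joinE /=; split=> [[w uw]|].
    by rewrite /= upset_joinE => -[]; [left | right]; exists w.
  by case=> -[w uw Xw]; exists w; rewrite //= upset_joinE; auto.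
- split=> [|X Y]; apply: eq_upsetP => u.
    by rewrite upset_botE; split=> // -[w _] /=; rewrite upset_topE.
  rewrite upset_joinE /=; split=> [[w uw]|].
    by rewrite /= upset_meetE => /not_andP[]; [left | right]; exists w.
  by case=> -[w uw Xw]; exists w; rewrite //= upset_meetE => // -[].
Qed.

End Upsets.

Section CanonicalFrame.
Context {d : Order.disp_t} {A : tbDistrLatticeType d}.

Record prime_filter := PrimeFilter {
  pf_set :> A -> Prop;
  pf_top : pf_set \top;
  pf_bot : ~ pf_set \bot;
  pf_up : forall a b, a <= b -> pf_set a -> pf_set b;
  pf_meet : forall a b, pf_set a -> pf_set b -> pf_set (a `&` b);
  pf_prime : forall a b, pf_set (a `|` b) -> pf_set a \/ pf_set b }.

Lemma prime_filter_inj (U V : prime_filter) :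
  (forall a, U a <-> V a) -> U = V.
Proof.
case: U V => [U u1 u2 u3 u4 u5] [V v1 v2 v3 v4 v5] /= UV.
have E : U = V by apply: funext => a; apply: propext.
by subst V; congr PrimeFilter; exact: Prop_irrelevance.
Qed.

Definition pf_le (U V : prime_filter) : Prop := forall a, U a -> V a.

Variable o : operations A.

Definition canonical_Rbox (e : sign) (U V : prime_filter) : Prop :=
  match e with
  | Plus => forall a, U (box o Plus a) -> V a
  | Minus => forall a, U (box o Minus a) -> ~ V a
  end.

Definition canonical_Rdia (e : sign) (U V : prime_filter) : Prop :=
  match e with
  | Plus => forall a, V a -> U (dia o Plus a)
  | Minus => forall a, ~ V a -> U (dia o Minus a)
  end.

Fact pf_le_refl U : pf_le U U.
Proof. by []. Qed.

Fact pf_le_trans U V W : pf_le U V -> pf_le V W -> pf_le U W.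
Proof. by move=> UV VW a /UV/VW. Qed.

Fact pf_le_anti U V : pf_le U V -> pf_le V U -> U = V.
Proof. by move=> UV VU; apply: prime_filter_inj => a; split=> [/UV|/VU]. Qed.

Fact canonical_Rbox_le e U U' V' V :
  pf_le U U' -> canonical_Rbox e U' V' -> signed_le pf_le e V' V ->
  canonical_Rbox e U V.
Proof.
by case: e => /= UU R VV a /UU/R; [exact: VV | move=> nV /VV].
Qed.

Fact canonical_Rdia_le e U U' V' V :
  pf_le U' U -> canonical_Rdia e U' V' -> signed_le pf_le e V V' ->
  canonical_Rdia e U V.
Proof.
case: e => /= UU R VV a Va; apply/UU/R; first exact: VV.
by move=> /VV.
Qed.

Definition canonical_frame : frame := {|
  world := prime_filter;
  fle := pf_le;
  Rbox := canonical_Rbox;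
  Rdia := canonical_Rdia;
  fle_refl := pf_le_refl;
  fle_trans := pf_le_trans;
  fle_anti := pf_le_anti;
  Rbox_fle := canonical_Rbox_le;
  Rdia_fle := canonical_Rdia_le |}.

Definition canonical_extension : operations (upset canonical_frame) :=
  complex_algebra canonical_frame.

End CanonicalFrame.

(* The pairs (Delta_alpha, nabla_beta); the last two constructors are those of
   the backward modalities. *)
Inductive label :=
  | DiaBox of sign & sign
  | BoxDia of sign & sign
  | BackDiaBox of sign & sign
  | BackBoxDia of sign & sign.

Definition star_equation (l : label) : inequality :=
  let a := Var 0 in
  let b := Var 1 in
  let boxp := TBox Plus in
  let boxm := TBox Minus in
  let diap := TDia Plus in
  let diam := TDia Minus in
  match l with
  | DiaBox Plus Plus => (TMeet (boxp a) (diap b), diap (TMeet a b))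
  | DiaBox Minus Minus => (TMeet (boxm a) (diam b), diam (TJoin a b))
  | BoxDia Plus Plus => (boxp (TJoin a b), TJoin (boxp a) (diap b))
  | BoxDia Minus Minus => (boxm (TMeet a b), TJoin (boxm a) (diam b))
  | DiaBox Plus Minus => (TMeet (boxm a) (diap a), TBot)
  | DiaBox Minus Plus => (TMeet (boxp a) (diam a), TBot)
  | BoxDia Plus Minus => (TTop, TJoin (boxp a) (diam a))
  | BoxDia Minus Plus => (TTop, TJoin (boxm a) (diap a))
  | BackDiaBox Plus Plus => (TImp (diap a) (boxp b), boxp (TImp a b))
  | BackDiaBox Minus Minus => (diam (TImp a b), TCoimp (diam b) (boxm a))
  | BackBoxDia Plus Plus => (diap (TCoimp b a), TCoimp (diap b) (boxp a))
  | BackBoxDia Minus Minus => (TImp (diam a) (boxm b), boxm (TCoimp b a))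
  | BackDiaBox Plus Minus => (boxm a, boxp (TImp a TBot))
  | BackDiaBox Minus Plus => (diam (TImp a TBot), diap a)
  | BackBoxDia Plus Minus => (diap (TCoimp TTop a), diam a)
  | BackBoxDia Minus Plus => (boxp a, boxm (TCoimp TTop a))
  end.

Definition star_condition (F : frame) (l : label) : Prop :=
  let le := @fle F in
  let ge := fun u v => @fle F v u in
  let Rboxp := @Rbox F Plus in
  let Rboxm := @Rbox F Minus in
  let Rdiap := @Rdia F Plus in
  let Rdiam := @Rdia F Minus in
  match l with
  | DiaBox Plus Plus => rel_incl Rdiap (rel_comp (rel_cap Rdiap Rboxp) ge)
  | DiaBox Minus Minus => rel_incl Rdiam (rel_comp (rel_cap Rdiam Rboxm) le)
  | BoxDia Plus Plus => rel_incl Rboxp (rel_comp (rel_cap Rboxp Rdiap) le)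
  | BoxDia Minus Minus => rel_incl Rboxm (rel_comp (rel_cap Rboxm Rdiam) ge)
  | DiaBox Plus Minus => rel_incl Rdiap Rboxm
  | DiaBox Minus Plus => rel_incl Rdiam Rboxp
  | BoxDia Plus Minus => rel_incl Rboxp Rdiam
  | BoxDia Minus Plus => rel_incl Rboxm Rdiap
  | BackDiaBox Plus Plus => rel_incl Rboxp (rel_comp le (rel_cap Rboxp Rdiap))
  | BackDiaBox Minus Minus => rel_incl Rdiam (rel_comp ge (rel_cap Rdiam Rboxm))
  | BackBoxDia Plus Plus => rel_incl Rdiap (rel_comp ge (rel_cap Rdiap Rboxp))
  | BackBoxDia Minus Minus => rel_incl Rboxm (rel_comp le (rel_cap Rboxm Rdiam))
  | BackDiaBox Plus Minus => rel_incl Rboxp Rboxm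
  | BackDiaBox Minus Plus => rel_incl Rdiam Rdiap
  | BackBoxDia Plus Minus => rel_incl Rdiap Rdiam
  | BackBoxDia Minus Plus => rel_incl Rboxm Rboxp
  end.

(* Main.v *)
(**
The frame conditions are first-order correspondents of the equations on every
frame: the failure of a condition at a pair [(u, v)] is witnessed by valuations
among the upset of [v], the complement of the downset of [v], and the image of
[u] under a box relation or the complement of its image under a diamond
relation.

For canonicity, the condition on the canonical frame asks either for a mere
implication between memberships, or for a prime filter above (or below) a given
one which contains a certain set and avoids another one.  The sets in question
are directed because the modalities preserve, reverse, or are monotone for
meets and joins, and the equation says exactly that the prime filter theorem
applies to them.
*)
Require Import Defs.
From HB Require Import structures.
From mathcomp Require Import all_boot all_order.
From mathcomp Require Import boolp classical_sets.

Set Implicit Arguments.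
Unset Strict Implicit.
Unset Printing Implicit Defensive.

Import Order.TTheory.
Local Open Scope order_scope.

(** * Separating directed sets by prime filters *)

Section PrimeFilterTheorem.
Context {d : Order.disp_t} {A : tbDistrLatticeType d}.
Implicit Types (F I G : A -> Prop) (U V : @prime_filter d A).

Definition down_directed F : Prop :=
  (exists a, F a) /\
  forall a b, F a -> F b -> exists2 c, F c & c <= a `&` b.

Definition up_directed I : Prop :=
  (exists a, I a) /\
  forall a b, I a -> I b -> exists2 c, I c & a `|` b <= c.

Definition filter_avoiding I G : Prop :=
  [/\ forall a b, a <= b -> G a -> G b,
      forall a b, G a -> G b -> G (a `&` b) &
      forall a, I a -> ~ G a].

(** Zorn's lemma gives a filter maximal among those that extend [F] and miss [I]; distributivity
    makes it prime. *)
Theorem prime_filter_separation F I :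
  down_directed F -> up_directed I ->
  (forall a i, F a -> I i -> ~ a <= i) ->
  exists U : prime_filter, (forall a, F a -> U a) /\ (forall a, I a -> ~ U a).
Proof.
move=> [[f0 Ff0] dF] [[i0 Ii0] dI] FI.
pose F0 : set A := fun a => exists2 f, F f & f <= a.
(* Joining [F0] makes the union of the empty chain admissible. *)
pose P : set (set A) := fun X => filter_avoiding I (F0 `|` X)%classic.
have P0 : P set0.
  rewrite /P setU0; split.
  - by move=> a b ab [f Ff fa]; exists f => //; exact: le_trans fa ab.
  - move=> a b [f Ff fa] [g Fg gb]; have [h Fh hfg] := dF _ _ Ff Fg.
    by exists h => //; exact: le_trans hfg (leI2 fa gb).
  - by move=> a Ia [f Ff fa]; exact: FI Ff Ia fa.
have [F0up F0meet F0I] : filter_avoiding I F0 by move: P0; rewrite /P setU0.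
have [C CP Ctot|M [[Mup Mmeet MI] Mmax]] := @Zorn_bigcup A P.
  split.
  - move=> a b ab [F0a|[X CX Xa]]; first by left; exact: F0up ab F0a.
    have [Xup _ _] := CP _ CX; have [] := Xup _ _ ab (or_intror Xa).
      by left.
    by move=> Xb; right; exists X.
  - have in_union X c : C X -> (F0 `|` X)%classic c ->
        (F0 `|` \bigcup_(Y in C) Y)%classic c.
      by move=> CX [?|?]; [left | right; exists X].
    move=> a b [F0a|[X CX Xa]] [F0b|[Y CY Yb]].
    + by left; exact: F0meet.
    + have [_ Ym _] := CP _ CY; apply: (in_union _ _ CY).
      by apply: Ym; [left | right].
    + have [_ Xm _] := CP _ CX; apply: (in_union _ _ CX).
      by apply: Xm; [right | left].
    + have [XY|YX] := Ctot _ _ CX CY.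
        have [_ Ym _] := CP _ CY; apply: (in_union _ _ CY).
        by apply: Ym; right => //; exact: XY.
      have [_ Xm _] := CP _ CX; apply: (in_union _ _ CX).
      by apply: Xm; right => //; exact: YX.
  - move=> a Ia [|[X CX Xa]]; first exact: F0I.
    by have [_ _ XI] := CP _ CX; apply: (XI _ Ia); right.
set G := (F0 `|` M)%classic in Mup Mmeet MI.
have Gf0 : G f0 by left; exists f0.
(* By maximality, the filter [H] generated by [G] and [x] must meet [I]. *)
have meetsI x : ~ G x -> exists2 g, G g & exists2 i, I i & g `&` x <= i.
  move=> nGx; apply: contrapT => nI.
  pose H : set A := fun c => exists2 g, G g & g `&` x <= c.
  have GH : (G `<=` H)%classic by move=> g Gg; exists g => //; exact: leIl.
  apply: (Mmax H); first split.
  - by move=> a Ma; apply: GH; right.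
  - move=> HM; apply: nGx; right; apply: HM.
    by exists f0 => //; exact: leIr.
  - have -> : P H = filter_avoiding I H.
      rewrite /P; congr filter_avoiding; apply: setUidr.
      by move=> a F0a; apply: GH; left.
    split.
    + by move=> a b ab [g Gg ga]; exists g => //; exact: le_trans ga ab.
    + move=> a b [g Gg ga] [h Gh hb]; exists (g `&` h); first exact: Mmeet.
      by rewrite lexI (le_trans _ ga) ?(le_trans _ hb) // leI2 // ?leIl ?leIr.
    + by move=> a Ia [g Gg ga]; apply: nI; exists g => //; exists a.
have Gprime a b : G (a `|` b) -> G a \/ G b.
  move=> Gab; apply: contrapT => /not_orP[/meetsI[g Gg [i Ii gi]]].
  move=> /meetsI[h Gh [j Ij hj]]; have [k Ik ijk] := dI _ _ Ii Ij.
  (* By distributivity, the meet of [g], [h] and a ∨ b lies below i ∨ j, hence below [k], which [G]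
     omits. *)
  apply: (MI _ Ik); apply: (Mup ((g `&` h) `&` (a `|` b))).
    apply: le_trans ijk; rewrite meetUr; apply: leU2.
      by apply: le_trans gi; rewrite leI2 ?leIl.
    by apply: le_trans hj; rewrite leI2 ?leIr.
  by apply: (Mmeet) => //; exact: Mmeet.
have Gtop : G \top by apply: Mup Gf0; exact: lex1.
have Gbot : ~ G \bot.
  by move=> Gbot; apply: (MI _ Ii0); apply: Mup Gbot; exact: le0x.
exists (PrimeFilter Gtop Gbot Mup Mmeet Gprime); split=> //= a Fa.
by left; exists a.
Qed.

(** The meets of members of [F] with members of [V] form a base of the filter generated by both, to
    which separation applies. *)
Corollary prime_filter_above V F I :
  down_directed F -> up_directed I ->
  (forall v a i, V v -> F a -> I i -> ~ a `&` v <= i) ->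
  exists U, [/\ pf_le V U, forall a, F a -> U a & forall a, I a -> ~ U a].
Proof.
move=> [[f0 Ff0] dF] uI VFI.
pose VF c := exists2 a, F a & exists2 v, V v & c = a `&` v.
have [||U [VFU IU]] := @prime_filter_separation VF I _ uI.
- split; first by exists (f0 `&` \top), f0 => //; exists \top => //; exact: pf_top.
  move=> _ _ [a Fa [v Vv ->]] [b Fb [w Vw ->]]; have [c Fc cab] := dF _ _ Fa Fb.
  exists (c `&` (v `&` w)); last by rewrite meetACA leI2.
  by exists c => //; exists (v `&` w) => //; exact: pf_meet.
- by move=> _ i [a Fa [v Vv ->]] Ii; exact: VFI Vv Fa Ii.
exists U; split=> // [v Vv|a Fa].
  by apply: pf_up (VFU (f0 `&` v) _); [exact: leIr | exists f0 => //; exists v].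
apply: pf_up (VFU (a `&` \top) _); first exact: leIl.
by exists a => //; exists \top => //; exact: pf_top.
Qed.

(** The complement of [V] is an ideal by primeness, so its joins with members of [I] are
    up-directed; a prime filter avoiding them lies below [V]. *)
Corollary prime_filter_below V F I :
  down_directed F -> up_directed I ->
  (forall v a i, ~ V v -> F a -> I i -> ~ a <= i `|` v) ->
  exists U, [/\ pf_le U V, forall a, F a -> U a & forall a, I a -> ~ U a].
Proof.
move=> dF [[i0 Ii0] uI] VFI.
pose VI c := exists2 i, I i & exists2 v, ~ V v & c = i `|` v.
have [||U [FU VIU]] := @prime_filter_separation F VI dF.
- split; first by exists (i0 `|` \bot), i0 => //; exists \bot => //; exact: pf_bot.
  move=> _ _ [a Ia [v Vv ->]] [b Ib [w Vw ->]]; have [c Ic cab] := uI _ _ Ia Ib.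
  exists (c `|` (v `|` w)); last by rewrite joinACA leU2.
  by exists c => //; exists (v `|` w) => // /pf_prime[].
- by move=> a _ Fa [i Ii [v Vv ->]]; exact: VFI Vv Fa Ii.
exists U; split=> // [v Uv|a Ia Ua].
  apply: contrapT => nVv; apply: (VIU (i0 `|` v)).
    by exists i0 => //; exists v.
  exact: pf_up (leUr _ _) Uv.
apply: (VIU (a `|` \bot)); last exact: pf_up (leUl _ _) Ua.
by exists a => //; exists \bot => //; exact: pf_bot.
Qed.

End PrimeFilterTheorem.

(** * Modalities on prime filters and canonicity *)

Section Modalities.
Context {d : Order.disp_t} {A : tbDistrLatticeType d} (o : operations A).
Implicit Types U V : @prime_filter d A.

Lemma box_plus_homo : connective_law o (Box Plus) ->
  {homo box o Plus : a b / a <= b}.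
Proof. by move=> [_ boxI] a b /meet_idPl ab; rewrite -ab boxI leIr. Qed.

Lemma dia_plus_homo : connective_law o (Dia Plus) ->
  {homo dia o Plus : a b / a <= b}.
Proof. by move=> [_ diaU] a b /join_idPl ab; rewrite -ab diaU leUr. Qed.

Lemma box_minus_anti : connective_law o (Box Minus) ->
  {homo box o Minus : a b /~ a <= b}.
Proof. by move=> [_ boxU] a b /join_idPl ab; rewrite -ab boxU leIr. Qed.

Lemma dia_minus_anti : connective_law o (Dia Minus) ->
  {homo dia o Minus : a b /~ a <= b}.
Proof. by move=> [_ diaI] a b /meet_idPl ab; rewrite -ab diaI leUr. Qed.

(** This preimage and the next three hold what [U] demands of a successor: to contain the set for
    [Box Plus] and [Dia Minus], to avoid it for [Dia Plus] and [Box Minus]. *)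
Lemma box_plus_preimage_directed U : connective_law o (Box Plus) ->
  down_directed (fun a => U (box o Plus a)).
Proof.
move=> [boxT boxI]; split; first by exists \top; rewrite boxT; exact: pf_top.
by move=> a b Ua Ub; exists (a `&` b) => //; rewrite boxI; exact: pf_meet.
Qed.

Lemma dia_plus_preimage_directed U : connective_law o (Dia Plus) ->
  up_directed (fun a => ~ U (dia o Plus a)).
Proof.
move=> [diaB diaU]; split; first by exists \bot; rewrite diaB; exact: pf_bot.
by move=> a b Ua Ub; exists (a `|` b) => //; rewrite diaU => /pf_prime[].
Qed.

Lemma box_minus_preimage_directed U : connective_law o (Box Minus) ->
  up_directed (fun a => U (box o Minus a)).
Proof.
move=> [boxB boxU]; split; first by exists \bot; rewrite boxB; exact: pf_top.
by move=> a b Ua Ub; exists (a `|` b) => //; rewrite boxU; exact: pf_meet.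
Qed.

Lemma dia_minus_preimage_directed U : connective_law o (Dia Minus) ->
  down_directed (fun a => ~ U (dia o Minus a)).
Proof.
move=> [diaT diaI]; split; first by exists \top; rewrite diaT; exact: pf_bot.
by move=> a b Ua Ub; exists (a `&` b) => //; rewrite diaI => /pf_prime[].
Qed.

(** The images hold what [V] demands of a predecessor: to contain the diamonds and avoid the boxes.
    Monotonicity or antitonicity gives directedness. *)
Lemma dia_plus_image_directed V : connective_law o (Dia Plus) ->
  down_directed (fun c => exists2 a, V a & c = dia o Plus a).
Proof.
move=> /dia_plus_homo dia_le; split.
  by exists (dia o Plus \top), \top => //; exact: pf_top.
move=> _ _ [a Va ->] [b Vb ->]; exists (dia o Plus (a `&` b)).
  by exists (a `&` b) => //; exact: pf_meet.
by rewrite lexI !dia_le ?leIl ?leIr.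
Qed.

Lemma box_plus_image_directed V : connective_law o (Box Plus) ->
  up_directed (fun c => exists2 a, ~ V a & c = box o Plus a).
Proof.
move=> /box_plus_homo box_le; split.
  by exists (box o Plus \bot), \bot => //; exact: pf_bot.
move=> _ _ [a Va ->] [b Vb ->]; exists (box o Plus (a `|` b)).
  by exists (a `|` b) => // /pf_prime[].
by rewrite leUx !box_le ?leUl ?leUr.
Qed.

Lemma dia_minus_image_directed V : connective_law o (Dia Minus) ->
  down_directed (fun c => exists2 a, ~ V a & c = dia o Minus a).
Proof.
move=> /dia_minus_anti dia_le; split.
  by exists (dia o Minus \bot), \bot => //; exact: pf_bot.
move=> _ _ [a Va ->] [b Vb ->]; exists (dia o Minus (a `|` b)).
  by exists (a `|` b) => // /pf_prime[].
by rewrite lexI !dia_le ?leUl ?leUr.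
Qed.

Lemma box_minus_image_directed V : connective_law o (Box Minus) ->
  up_directed (fun c => exists2 a, V a & c = box o Minus a).
Proof.
move=> /box_minus_anti box_le; split.
  by exists (box o Minus \top), \top => //; exact: pf_top.
move=> _ _ [a Va ->] [b Vb ->]; exists (box o Minus (a `&` b)).
  by exists (a `&` b) => //; exact: pf_meet.
by rewrite leUx !box_le ?leIl ?leIr.
Qed.

Lemma imp_mp (a b : A) : connective_law o Imp -> imp o a b `&` a <= b.
Proof. by move=> impP; rewrite -impP. Qed.

Lemma coimp_mp (a b : A) : connective_law o Coimp -> a <= b `|` coimp o a b.
Proof. by move=> coimpP; rewrite -coimpP. Qed.

(** The equations mention only [Var 0] and [Var 1]; all larger indices default to [b]. *)
Definition valuation2 (T : Type) (a b : T) (i : nat) : T :=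
  if i is 0 then a else b.

(** With equal signs, a forward label calls for a successor [W] of [U] comparable with [V], a
    backward one for a predecessor [W] of [V] comparable with [U]. Opposite signs need only a
    membership argument. *)
Theorem star_canonical (l : label) :
  algebra_for o (star_equation l) -> satisfies o (star_equation l) ->
  star_condition (canonical_frame o) l.
Proof.
move=> HA sat.
have {}sat a b := sat (valuation2 a b).
have law c : occurs_in c (star_equation l) -> connective_law o c := HA c.
case: l sat law {HA} => [[] []|[] []|[] []|[] []] /= sat law U V /= UV.
- have bp : connective_law o (Box Plus) by apply: law; cbv; tauto.
  have dp : connective_law o (Dia Plus) by apply: law; cbv; tauto.
  have [v a i Vv Ua nUi le_i|W [VW FW IW]] := @prime_filter_above _ _ V _ _
      (box_plus_preimage_directed U bp) (dia_plus_preimage_directed U dp).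
    (* The equation puts the diamond of a ∧ v in [U], hence that of [i], a contradiction. *)
    apply/nUi/(pf_up (dia_plus_homo dp le_i))/(pf_up (sat a v)).
    by apply: pf_meet => //; exact: UV.
  exists W => //; split=> // a Wa; apply: contrapT => /IW; exact.
- move=> a Ua Va; apply: (@pf_bot _ _ U); apply: pf_up (sat a a) _.
  by apply: pf_meet => //; exact: UV.
- move=> a Ua; apply: contrapT => nVa; apply: (@pf_bot _ _ U).
  by apply: pf_up (sat a a) _; apply: pf_meet => //; exact: UV.
- have bm : connective_law o (Box Minus) by apply: law; cbv; tauto.
  have dm : connective_law o (Dia Minus) by apply: law; cbv; tauto.
  have [v a i nVv nUa Ui le_a|W [WV FW IW]] := @prime_filter_below _ _ V _ _
      (dia_minus_preimage_directed U dm) (box_minus_preimage_directed U bm).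
    apply/nUa/(pf_up (dia_minus_anti dm le_a))/(pf_up (sat i v)).
    by apply: pf_meet => //; exact: UV.
  exists W => //; split=> // a nWa; apply: contrapT => /FW; exact.
- have bp : connective_law o (Box Plus) by apply: law; cbv; tauto.
  have dp : connective_law o (Dia Plus) by apply: law; cbv; tauto.
  have [v a i nVv Ua nUi le_a|W [WV FW IW]] := @prime_filter_below _ _ V _ _
      (box_plus_preimage_directed U bp) (dia_plus_preimage_directed U dp).
    rewrite joinC in le_a.
    (* Both disjuncts are excluded: the first would put [v] in [V], the second contradicts the
       choice of [i]. *)
    have /pf_prime[/UV//|//] : U (box o Plus v `|` dia o Plus i).
    exact/(pf_up (sat v i))/(pf_up (box_plus_homo bp le_a)).
  exists W => //; split=> // a Wa; apply: contrapT => /IW; exact.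
- move=> a nVa; have := pf_up (sat a a) (pf_top U).
  by move=> /pf_prime[/UV|].
- move=> a Va; have := pf_up (sat a a) (pf_top U).
  by move=> /pf_prime[/UV|].
- have bm : connective_law o (Box Minus) by apply: law; cbv; tauto.
  have dm : connective_law o (Dia Minus) by apply: law; cbv; tauto.
  have [v a i Vv nUa Ui le_i|W [VW FW IW]] := @prime_filter_above _ _ V _ _
      (dia_minus_preimage_directed U dm) (box_minus_preimage_directed U bm).
    rewrite meetC in le_i.
    have /pf_prime[/UV//|//] : U (box o Minus v `|` dia o Minus a).
    exact/(pf_up (sat v a))/(pf_up (box_minus_anti bm le_i)).
  exists W => //; split=> // a nWa; apply: contrapT => /FW; exact.
- have bp : connective_law o (Box Plus) by apply: law; cbv; tauto.
  have dp : connective_law o (Dia Plus) by apply: law; cbv; tauto.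
  have im : connective_law o Imp by apply: law; cbv; tauto.
  have [u _ _ Uu [a Va ->] [b nVb ->]|W [UW FW IW]] :=
      @prime_filter_above _ _ U _ _
        (dia_plus_image_directed V dp) (box_plus_image_directed V bp).
    (* Residuation bounds [u] by the left side of the equation, so a → b is in [V], and modus ponens
       yields [b]. *)
    rewrite meetC -im => le_u; apply/nVb/(pf_up (imp_mp a b im)).
    by apply: pf_meet => //; apply/UV/(pf_up (sat a b))/(pf_up le_u).
  exists W => //; split=> a Ha; last by apply: FW; exists a.
  by apply: contrapT => nVa; apply: IW Ha; exists a.
- have im : connective_law o Imp by apply: law; cbv; tauto.
  move=> a Ua Va; apply: (@pf_bot _ _ V); apply: pf_up (imp_mp a \bot im) _.
  by apply: pf_meet => //; apply/UV/(pf_up (sat a a)).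
- have im : connective_law o Imp by apply: law; cbv; tauto.
  move=> a Va; apply: pf_up (sat a a) _; apply: UV => Vna.
  apply: (@pf_bot _ _ V); apply: pf_up (imp_mp a \bot im) _; exact: pf_meet.
- have bm : connective_law o (Box Minus) by apply: law; cbv; tauto.
  have dm : connective_law o (Dia Minus) by apply: law; cbv; tauto.
  have im : connective_law o Imp by apply: law; cbv; tauto.
  have co : connective_law o Coimp by apply: law; cbv; tauto.
  have [u _ _ nUu [b nVb ->] [a Va ->]|W [WU FW IW]] :=
      @prime_filter_below _ _ U _ _
        (dia_minus_image_directed V dm) (box_minus_image_directed V bm).
    (* Now [u] bounds the right side of the equation; [V] has [a] but not [b], so it omits a → b,
       and the relation then forces [u] into [U]. *)
    rewrite -co => le_u; apply/nUu/(pf_up le_u)/(pf_up (sat a b)).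
    apply: UV => Vab; apply/nVb/(pf_up (imp_mp a b im)); exact: pf_meet.
  exists W => //; split=> a Ha; first by apply: FW; exists a.
  by move=> Va; apply: IW Ha; exists a.
- have bp : connective_law o (Box Plus) by apply: law; cbv; tauto.
  have dp : connective_law o (Dia Plus) by apply: law; cbv; tauto.
  have co : connective_law o Coimp by apply: law; cbv; tauto.
  have [u _ _ nUu [b Vb ->] [a nVa ->]|W [WU FW IW]] :=
      @prime_filter_below _ _ U _ _
        (dia_plus_image_directed V dp) (box_plus_image_directed V bp).
    rewrite -co => le_u; apply/nUu/(pf_up le_u)/(pf_up (sat a b)).
    by apply: UV; have /pf_prime[|] := pf_up (coimp_mp b a co) Vb.
  exists W => //; split=> a Ha; first by apply: FW; exists a.
  by apply: contrapT => nVa; apply: IW Ha; exists a.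
- have co : connective_law o Coimp by apply: law; cbv; tauto.
  move=> a nVa; apply: pf_up (sat a a) _; apply: UV.
  by have /pf_prime[|] := pf_up (coimp_mp \top a co) (pf_top V).
- have co : connective_law o Coimp by apply: law; cbv; tauto.
  move=> a Ua; have /pf_prime[//|] := pf_up (coimp_mp \top a co) (pf_top V).
  by have /UV := pf_up (sat a a) Ua.
- have bm : connective_law o (Box Minus) by apply: law; cbv; tauto.
  have dm : connective_law o (Dia Minus) by apply: law; cbv; tauto.
  have co : connective_law o Coimp by apply: law; cbv; tauto.
  have im : connective_law o Imp by apply: law; cbv; tauto.
  have [u _ _ Uu [a nVa ->] [b Vb ->]|W [UW FW IW]] :=
      @prime_filter_above _ _ U _ _
        (dia_minus_image_directed V dm) (box_minus_image_directed V bm).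
    (* The equation forces b - a out of [V], yet [V] contains [b] and omits [a]. *)
    rewrite meetC -im => /pf_up/(_ Uu)/(pf_up (sat a b))/UV; apply.
    by have /pf_prime[|] := pf_up (coimp_mp b a co) Vb.
  exists W => //; split=> a Ha; last by apply: FW; exists a.
  by move=> Va; apply: IW Ha; exists a.
Qed.

End Modalities.

(** * First-order correspondence on arbitrary frames *)

Section Correspondence.
Variable F : frame.
Implicit Types u v w : F.

Definition above v : upset F :=
  @mk_upset F (fun w => fle v w) (fun _ _ ww' vw => fle_trans vw ww').

Fact not_below_up v w w' : fle w w' -> ~ fle w v -> ~ fle w' v.
Proof. by move=> ww' nwv w'v; apply: nwv; exact: fle_trans ww' w'v. Qed.

(** The largest upset omitting [v], just as [above v] is the smallest one containing it. *)
Definition not_below v : upset F := mk_upset (@not_below_up v).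

Fact box_plus_image_up u w w' : fle w w' -> Rbox Plus u w -> Rbox Plus u w'.
Proof. by move=> ww' uw; exact: (Rbox_fle (fle_refl u) uw ww'). Qed.

(** The smallest upset whose positive box contains [u]. Likewise, [box_minus_nonimage u] is the
    largest whose negative box contains [u], and [dia_plus_nonimage u] the largest,
    [dia_minus_image u] the smallest, whose diamond omits [u]. *)
Definition box_plus_image u : upset F := mk_upset (@box_plus_image_up u).

Fact box_minus_nonimage_up u w w' :
  fle w w' -> ~ Rbox Minus u w -> ~ Rbox Minus u w'.
Proof. by move=> ww' nuw uw'; apply/nuw/(Rbox_fle (fle_refl u) uw' ww'). Qed.

Definition box_minus_nonimage u : upset F :=
  mk_upset (@box_minus_nonimage_up u).

Fact dia_plus_nonimage_up u w w' :
  fle w w' -> ~ Rdia Plus u w -> ~ Rdia Plus u w'.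
Proof. by move=> ww' nuw uw'; apply/nuw/(Rdia_fle (fle_refl u) uw' ww'). Qed.

Definition dia_plus_nonimage u : upset F := mk_upset (@dia_plus_nonimage_up u).

Fact dia_minus_image_up u w w' : fle w w' -> Rdia Minus u w -> Rdia Minus u w'.
Proof. by move=> ww' uw; exact: (Rdia_fle (fle_refl u) uw ww'). Qed.

Definition dia_minus_image u : upset F := mk_upset (@dia_minus_image_up u).

(** The condition supplies a world lying in both relations; membership passes along the order
    because valuations are upsets. *)
Lemma star_condition_satisfies (l : label) :
  star_condition F l -> satisfies (complex_algebra F) (star_equation l).
Proof.
move=> C v; apply/le_upsetP => u.
case: l C => [[] []|[] []|[] []|[] []] /= C;
  move: (v 0) (v 1) => a b {v}.
- move=> [ba [w uw bw]]; have [x [uxd uxb] wx] := C _ _ uw.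
  exists x => //; split; first exact: ba.
  exact: upsetP wx bw.
- by move=> [na [w uw aw]]; apply: (na w) => //; exact: C.
- by move=> [ba [w uw naw]]; apply: naw; apply: ba; exact: C.
- move=> [na [w uw nbw]]; have [x [uxd uxb] xw] := C _ _ uw.
  exists x => // -[]; first exact: na.
  by move=> bx; apply: nbw; exact: upsetP xw bx.
- move=> bab; have [db|ndb] := pselect (exists2 w, Rdia Plus u w & b w).
    by right.
  left=> w uw; have [x [uxb uxd] xw] := C _ _ uw.
  have [ax|bx] := bab _ uxb.
    exact: upsetP xw ax.
  by case: ndb; exists x.
- move=> _; have [da|nda] := pselect (exists2 w, Rdia Minus u w & ~ a w).
    by right.
  by left=> w uw; apply: contrapT => naw; apply: nda; exists w => //; exact: C.
- move=> _; have [da|nda] := pselect (exists2 w, Rdia Plus u w & a w).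
    by right.
  by left=> w uw aw; apply: nda; exists w => //; exact: C.
- move=> bab; have [db|ndb] := pselect (exists2 w, Rdia Minus u w & ~ b w).
    by right.
  left=> w uw aw; have [x [uxb uxd] wx] := C _ _ uw.
  apply: (bab _ uxb); split.
    exact: upsetP wx aw.
  by apply: contrapT => nbx; apply: ndb; exists x.
- move=> dab w uw x wx ax; have [u' uu' [u'wb u'wd]] := C _ _ uw.
  (* Raising [w] to [x] keeps the box relation; the condition at [u'] and [x] then gives one world
     seeing [x] through both relations. *)
  have u'xb : Rbox Plus u' x := box_plus_image_up wx u'wb.
  have [u'' u'u'' [u''xb u''xd]] := C _ _ u'xb.
  by apply: (dab u'') => //; [exact: fle_trans uu' u'u'' | exists x].
- by move=> na w uw x wx ax; apply: (na x) => //; apply/C/box_plus_image_up/uw.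
- move=> [w uw nnaw].
  have [x wx ax] : exists2 x, fle w x & a x.
    apply: contrapT => nax; apply: nnaw => x wx ax.
    by case: nax; exists x.
  by exists x => //; apply/C/(dia_minus_image_up wx).
- move=> [w uw nabw].
  have [x [wx ax nbx]] : exists x, [/\ fle w x, a x & ~ b x].
    apply: contrapT => nx; apply: nabw => x wx ax.
    by apply: contrapT => nbx; apply: nx; exists x.
  have [u' u'u [u'xd u'xb]] := C _ _ (dia_minus_image_up wx uw).
  by exists u'; split=> //; [exists x | move=> /(_ x u'xb)].
- move=> [w uw [x [xw bx nax]]].
  have ux : Rdia Plus u x := Rdia_fle (fle_refl u) uw xw.
  have [u' u'u [u'xd u'xb]] := C _ _ ux.
  by exists u'; split=> //; [exists x | move=> /(_ x u'xb)].
- move=> [w uw [x [xw _ nax]]]; exists x => //; apply: C.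
  exact: Rdia_fle (fle_refl u) uw xw.
- move=> ba w uw [x [xw _ nax]]; apply/nax/ba/C.
  exact: Rbox_fle (fle_refl u) uw xw.
- move=> dab w uw [x [xw bx nax]].
  have ux : Rbox Minus u x := Rbox_fle (fle_refl u) uw xw.
  have [u' uu' [u'xb u'xd]] := C _ _ ux.
  by apply: (dab u' uu' _ x u'xb bx); exists x.
Qed.

(** Extremal valuations make the left side hold at [u], or would if the condition failed; the right
    side then unfolds to the condition or to a contradiction. *)
Lemma satisfies_star_condition (l : label) :
  satisfies (complex_algebra F) (star_equation l) -> star_condition F l.
Proof.
move=> sat.
have {}sat a b u := le_upsetP _ _ (sat (valuation2 a b)) u.
case: l sat => [[] []|[] []|[] []|[] []] /= sat u v uv;
  have vv := fle_refl v.
- have [|w uw [uwb vw]] := sat (box_plus_image u) (above v) u.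
    by split=> //; exists v.
  by exists w.
- apply: contrapT => nuv.
  case: (sat (box_minus_nonimage u) (above v) u).
  by split=> [w uw /(_ uw)//|]; exists v.
- apply: contrapT => nuv.
  case: (sat (box_plus_image u) (above v) u).
  by split=> //; exists v.
- have [|w uw /not_orP[/contrapT uwb /contrapT wv]] :=
      sat (box_minus_nonimage u) (not_below v) u.
    by split=> [w uw /(_ uw)//|]; exists v => //; exact.
  by exists w.
- apply: contrapT => nw.
  (* If no [w] works, each box successor of [u] lies in one of the two upsets; but [v] refutes the
     box, and the definition of the nonimage refutes the diamond. *)
  have [|/(_ v uv)/(_ vv)//|[w uw /(_ uw)//]] :=
      sat (not_below v) (dia_plus_nonimage u) u.
  move=> w uw; apply: contrapT => /not_orP[/contrapT wv /contrapT uwd].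
  by apply: nw; exists w.
- have [//|/(_ v uv)/(_ vv)//|[w uw /contrapT wv]] :=
    sat (not_below v) (not_below v) u.
  exact: Rdia_fle (fle_refl u) uw wv.
- have [//|/(_ v uv)/(_ vv)//|[w uw vw]] := sat (above v) (above v) u.
  exact: Rdia_fle (fle_refl u) uw vw.
- apply: contrapT => nw.
  have [|/(_ v uv)/(_ vv)//|[w uw /(_ uw)//]] :=
      sat (above v) (dia_minus_image u) u.
  by move=> w uw [vw uwd]; apply: nw; exists w.
- apply: contrapT => nw.
  (* The implication fails at [v], so its premise must fail: some [u'] has a diamond successor above
     [v] and a box successor below [v], and both can be moved to [v]. *)
  apply: (sat (above v) (not_below v) u _ v uv v vv vv vv).
  move=> u' uu' [w u'w vw] x u'x xv; apply: nw; exists u' => //; split.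
    exact: box_plus_image_up xv u'x.
  exact: Rdia_fle (fle_refl u') u'w vw.
- apply: contrapT => nuv.
  apply: (sat (above v) (above v) u _ v uv v vv vv) => w uw vw.
  exact/nuv/(Rbox_fle (fle_refl u) uw vw).
- have [|w uw vw] := sat (above v) (above v) u.
    by exists v => // /(_ v vv vv).
  exact: Rdia_fle (fle_refl u) uw vw.
- have [|u' [u'u [w u'w /contrapT wv] nb]] := sat (above v) (not_below v) u.
    by exists v => // /(_ v vv vv)/(_ vv).
  exists u' => //; split; first exact: dia_minus_image_up wv u'w.
  apply: contrapT => nu'v; apply: nb => x u'x vx.
  exact: box_minus_nonimage_up vx nu'v u'x.
- have [|u' [u'u [w u'w vw] nb]] := sat (not_below v) (above v) u.
    by exists v => //; exists v; split=> //; exact.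
  exists u' => //; split; first exact: Rdia_fle (fle_refl u') u'w vw.
  apply: contrapT => nu'v; apply: nb => x u'x xv.
  exact/nu'v/(box_plus_image_up xv).
- have [|w uw /contrapT wv] := sat (not_below v) (not_below v) u.
    by exists v => //; exists v; split=> //; exact.
  exact: dia_minus_image_up wv uw.
- apply: contrapT => nuv.
  apply: (sat (not_below v) (not_below v) u _ v uv).
    by move=> w uw wv; exact/nuv/(box_plus_image_up wv).
  by exists v; split=> //; exact.
- apply: contrapT => nw.
  apply: (sat (not_below v) (above v) u _ v uv); last first.
    by exists v; split=> //; exact.
  move=> u' uu' [w u'w /contrapT wv] x u'x vx; apply: nw; exists u' => //.
  split; first exact: Rbox_fle (fle_refl u') u'x vx.
  exact: dia_minus_image_up wv u'w.
Qed.

End Correspondence.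

Theorem mainTheorem11 (l : label) (d : Order.disp_t) (A : tbDistrLatticeType d)
    (o : operations A) (HA : algebra_for o (star_equation l)) :
  (satisfies o (star_equation l) -> star_condition (canonical_frame o) l) /\
  (star_condition (canonical_frame o) l <->
     satisfies (canonical_extension o) (star_equation l)).
Proof.
split; first exact: star_canonical.
by split; [exact: star_condition_satisfies | exact: satisfies_star_condition].
Qed.
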